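(* Let $G$ be an undirected multigraph with unit edge weights on a vertex set $V$ with $|V|=n$, whose $m$ edges arrive as a stream $e_1,\dots,e_m$. Let $d>0$ be a constant, $\epsilon>0$, and let $H$ be an output of the algorithm Stream-Sparsification (described in the context) with parameter $\rho=32((4+d)\ln n+\ln m)(1+\epsilon)/\epsilon^2$. If $H\in(1\pm\epsilon)G$, then $H$ has $$O\!\left(n(d\log n+\log m)(\log m-\log n)\frac{(1+\epsilon)^2}{\epsilon^2}\right)$$ edges.
   Context: A cut $C$ is a partition of $V$ into two nonempty parts; for a weighted graph $K$ on $V$, $VAL(C,K)$ is the total weight of the edges of $K$ crossing $C$. $H\in(1\pm\epsilon)G$ means $(1-\epsilon)VAL(C,G)\le VAL(C,H)\le(1+\epsilon)VAL(C,G)$ for every cut $C$. A weighted graph is $k$-strongly connected if every cut of it has value at least $k$; a $k$-strong connected component is a maximal vertex-induced subgraph that is $k$-strongly connected. The strong connectivity of an edge $e=\{u,v\}$ in a weighted graph $K$ is the maximum $k$ such that some $k$-strong connected component of $K$ contains both $u$ and $v$ (it is $0$ if no positive $k$ works). Algorithm Stream-Sparsification with parameter $\rho>0$: start with $H=(V,\emptyset)$. For $i=1,\dots,m$: let $c_{e_i}$ be the strong connectivity of $e_i$ in the current $H$; set $p_{e_i}=\min\{\rho/c_{e_i},1\}$ ($=1$ if $c_{e_i}=0$); with probability $p_{e_i}$, independently, add $e_i$ to $H$ with weight $1/p_{e_i}$. The output is the final $H$.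
   Formalization: The bound fails when log m − log n is zero, negative or tends to 0 (an n-cycle has m = n and is kept whole), so the formal statement assumes log m − log n ≥ δ for a fixed δ > 0, and the O-constant depends only on δ; edges are assumed not to be loops. *)

(* Defs.v *)
From mathcomp Require Import all_boot all_order all_algebra.
From mathcomp Require Import classical_sets reals exp.

Set Implicit Arguments.
Unset Strict Implicit.
Unset Printing Implicit Defensive.
Import Order.TTheory GRing.Theory Num.Theory.
Local Open Scope ring_scope.

(* A weighted (multi)graph on V is the list of its weighted edges, each edge
   being a two-element vertex set; parallel edges are separate entries. *)
Notation wgraph R V := (seq ({set V} * R)).

Section Graphs.
Variables (R : realType) (V : finType).

Definition is_edge (e : {set V}) : bool := #|e| == 2%N.

Definition unit_wgraph (G : seq {set V}) : wgraph R V := [seq (e, 1) | e <- G].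

Definition cut (U : {set V}) (C : {set {set V}}) : bool :=
  finset.partition C U && (#|C| == 2%N).

Definition crosses (C : {set {set V}}) (e : {set V}) : bool :=
  [forall B in C, e :&: B != finset.set0].

Definition cut_value (C : {set {set V}}) (K : wgraph R V) : R :=
  \sum_(f <- K | crosses C f.1) f.2.

Definition cut_approx (eps : R) (G H : wgraph R V) : Prop :=
  forall C : {set {set V}}, cut [set: V] C ->
    (1 - eps) * cut_value C G <= cut_value C H <= (1 + eps) * cut_value C G.

Definition induced (K : wgraph R V) (U : {set V}) : wgraph R V :=
  [seq f : {set V} * R <- K | f.1 \subset U].

Definition strongly_connected (k : R) (K : wgraph R V) (U : {set V}) : bool :=
  [forall C : {set {set V}}, cut U C ==> (k <= cut_value C (induced K U))].

Definition strong_component (k : R) (K : wgraph R V) (U : {set V}) : bool :=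
  maxset (strongly_connected k K) U.

(* For a two-element e and nonnegative weights, this set of reals contains 0
   (V itself is 0-strongly connected) and its supremum is attained. *)
Definition strong_connectivity (K : wgraph R V) (e : {set V}) : R :=
  sup [set k : R | 0 <= k /\
         exists2 U : {set V}, strong_component k K U & e \subset U]%classic.

Definition sampling_prob (rho : R) (K : wgraph R V) (e : {set V}) : R :=
  let c := strong_connectivity K e in
  if c == 0 then 1 else Num.min (rho / c) 1.

Definition step (rho : R) (K : wgraph R V) (e : {set V}) (b : bool)
    : wgraph R V :=
  if b then rcons K (e, (sampling_prob rho K e)^-1) else K.

(* The graph obtained from K by processing the stream es when the successive
   coins come up as bs, and the probability of that sequence of coins. *)
Fixpoint run (rho : R) (K : wgraph R V) (es : seq {set V}) (bs : seq bool)
    : wgraph R V :=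
  match es, bs with
  | e :: es', b :: bs' => run rho (step rho K e b) es' bs'
  | _, _ => K
  end.

Fixpoint run_prob (rho : R) (K : wgraph R V) (es : seq {set V}) (bs : seq bool)
    : R :=
  match es, bs with
  | e :: es', b :: bs' =>
      let p := sampling_prob rho K e in
      (if b then p else 1 - p) * run_prob rho (step rho K e b) es' bs'
  | _, _ => 1
  end.

(* The outputs are the results of the coin sequences of positive probability. *)
Definition stream_sparsification_output (rho : R) (G : seq {set V})
    (H : wgraph R V) : Prop :=
  exists2 bs : (size G).-tuple bool,
    0 < run_prob rho [::] G bs & H = run rho [::] G bs.

End Graphs.

Definition sparsification_rho (R : realType) (d eps : R) (n m : nat) : R :=
  32 * ((4 + d) * ln n%:R + ln m%:R) * (1 + eps) / eps ^+ 2.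

(* Main.v *)
(** An edge sampled at strong connectivity [c] has weight [w = max (c / rho) 1].
    Fix [b > 1] and a level [b^i <= w < b^(i+1)]. If the edges of this level had
    an induced subgraph all of whose cuts contain more than [t >= rho * b] of
    them, then just before its last edge arrived this subgraph would have been
    [t * b^i]-strongly connected, so that edge would have weight at least
    [b^(i+1)]. Cutting recursively along cuts with at most [t] edges shows that
    the level has at most [(n - 1) * t] edges. Summing the singleton cuts bounds
    the total weight by [(1 + eps) * m], so all but [n] edges of [H] lie in the
    first [log_b ((1 + eps) * m / n)] levels. *)
Require Import Defs.
From mathcomp Require Import all_boot all_order all_algebra.
From mathcomp Require Import classical_sets reals exp.
From mathcomp Require Import finset zify ring lra.
Import Order.TTheory GRing.Theory Num.Theory.
Local Open Scope ring_scope.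

Set Implicit Arguments.
Unset Strict Implicit.

(** Serves to pick, in stream order, the last edge of a weight level inside a given vertex set. *)
Lemma last_occurrence (T : Type) (p : pred T) (s : seq T) :
  has p s -> exists s1 x s2, [/\ s = s1 ++ x :: s2, p x & ~~ has p s2].
Proof.
elim: s => //= x s IHs; case: (boolP (has p s)) => [/IHs|Nps] hp.
  have [s1 [y [s2 [-> py Np]]]] := hp.
  by exists (x :: s1), y, s2.
by exists [::], x, s; split=> //; rewrite orbF in hp.
Qed.

(** * Cuts as pairs of disjoint sets, and recursive cutting *)

Section Cuts.
Variable V : finType.
Implicit Types (U A B e : {set V}) (C : {set {set V}}).

Lemma cutP U C : cut U C ->
  exists A B, [/\ C = [set A; B]%SET, A :|: B = U, [disjoint A & B],
                  (0 < #|A|)%N & (0 < #|B|)%N].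
Proof.
case/andP=> /and3P[/eqP covC /trivIsetP trivC NC0] /cards2P[A [B [AB defC]]].
exists A, B; split=> //.
- by rewrite -covC defC /cover bigcup_setU !big_set1.
- by apply: trivC; rewrite // defC !inE eqxx ?orbT.
- by rewrite card_gt0; apply: contraNneq NC0 => <-; rewrite defC !inE eqxx.
- by rewrite card_gt0; apply: contraNneq NC0 => <-; rewrite defC !inE eqxx orbT.
Qed.

Lemma cut_set2 A B : [disjoint A & B] -> (0 < #|A|)%N -> (0 < #|B|)%N ->
  cut (A :|: B) [set A; B]%SET.
Proof.
rewrite !card_gt0 => dAB A0 B0.
have AB : A != B.
  by apply: contraNneq A0 => AB; move: dAB; rewrite -AB -setI_eq0 setIid.
rewrite /cut cards2 AB andbT; apply/and3P; split.
- by rewrite /cover bigcup_setU !big_set1.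
- apply/trivIsetP=> X Y; rewrite !inE.
  case/orP=> /eqP-> /orP[]/eqP-> //; rewrite ?eqxx // => _.
  by rewrite disjoint_sym.
- by rewrite !inE negb_or eq_sym A0 eq_sym B0.
Qed.

Lemma crosses_set2 A B e :
  crosses [set A; B]%SET e = (e :&: A != set0) && (e :&: B != set0).
Proof.
apply/forall_inP/andP => [h|[hA hB] X].
  by split; apply: h; rewrite !inE eqxx ?orbT.
by rewrite !inE => /orP[]/eqP->.
Qed.

Lemma exists_cut U : (1 < #|U|)%N -> exists C, cut U C.
Proof.
move=> U1; have /card_gt0P[v vU] : (0 < #|U|)%N by apply: ltnW.
exists [set [set v]; U :\ v]%SET; rewrite -{1}(setD1K vU).
apply: cut_set2; first by rewrite disjoints1 !inE eqxx.
  by rewrite cards1.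
by move: U1; rewrite (cardsD1 v) vU.
Qed.

(** Induction on [#|U|]: a small cut splits [U] into [A] and [B], and an edge inside [U] lies in
    [A], lies in [B], or is one of at most [t] crossing edges. The number of cuts made adds up as
    [(#|A| - 1) + (#|B| - 1) + 1 = #|U| - 1]. *)
Lemma count_le_of_small_cuts (S : seq {set V}) (t : nat) :
    all (@is_edge V) S ->
    (forall U, (1 < #|U|)%N -> exists2 C, cut U C &
       (count (fun e => (e \subset U) && crosses C e) S <= t)%N) ->
  forall U, (count (fun e => e \subset U) S <= #|U|.-1 * t)%N.
Proof.
move=> edgeS smallcut U; have [k] := ubnP #|U|.
elim: k U => // k IHk U Uk.
have [U1|U1] := leqP #|U| 1.
  rewrite (@eq_in_count _ _ pred0) ?count_pred0 // => e /(allP edgeS) /eqP e2.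
  by apply: contraTF U1 => /subset_leq_card; rewrite e2 -ltnNge.
have [C /cutP[A [B [defC defU dAB A0 B0]]] Ct] := smallcut U U1.
have cU : #|U| = (#|A| + #|B|)%N.
  by rewrite -defU cardsU; move: dAB; rewrite -setI_eq0 => /eqP->; rewrite cards0 subn0.
have cA : (#|A| < k)%N by lia.
have cB : (#|B| < k)%N by lia.
have := IHk A cA; have := IHk B cB.
have le3 : (count (fun e => e \subset U) S <=
   count (fun e => e \subset A) S + count (fun e => e \subset B) S +
   count (fun e => (e \subset U) && crosses C e) S)%N.
  elim: (S) => //= e S' IH.
  have : ((e \subset U) <= (e \subset A) + (e \subset B) +
     ((e \subset U) && crosses C e))%N.
    case: (boolP (e \subset U)) => //= eU.
    rewrite defC crosses_set2.
    case: (boolP (e \subset A)) => // NA; case: (boolP (e \subset B)) => // NB.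
    have sub X Y : X :|: Y = U -> ~~ (e \subset Y) -> e :&: X != set0.
      move=> XY; apply: contraNneq => eX0; apply/fintype.subsetP => x xe.
      have := fintype.subsetP eU x xe; rewrite -XY inE => /orP[xX|//].
      by move/setP/(_ x): eX0; rewrite !inE xe xX.
    by rewrite (sub A B) // (sub B A) // setUC.
  by move: IH; lia.
have -> : #|U|.-1 = (#|A|.-1 + #|B|.-1 + 1)%N by lia.
by rewrite !mulnDl mul1n; lia.
Qed.

End Cuts.

(** * Strong connectivity, sampled weights and weight levels *)

Section Weighted.
Variables (R : realType) (V : finType).
Implicit Types (K H : wgraph R V) (U e : {set V}).

Lemma le_strong_connectivity K e U (k : R) :
    (forall f, f \in K -> 0 <= f.2) -> is_edge e -> 0 <= k ->
    e \subset U -> strongly_connected k K U ->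
  k <= strong_connectivity K e.
Proof.
move=> K0 /eqP e2 k0 eU scU.
apply: ub_le_sup; last first.
  by split=> //; have [U' maxU' UU'] := maxset_exists scU; exists U';
     [exact: maxU' | exact: fintype.subset_trans UU'].
(* The supremum is over a bounded set: a component containing the two ends of [e] has a cut, and no
   cut exceeds the total weight. *)
exists (\sum_(f <- K) f.2) => l [_ [W /maxsetP[/forallP scW _] eW]].
have [|C cutC] := @exists_cut V W.
  by have := subset_leq_card eW; rewrite e2.
have := scW C; rewrite cutC /= => /le_trans; apply.
rewrite /cut_value big_filter_cond big_mkcond big_seq [leRHS]big_seq.
by apply: ler_sum => f /K0; case: ifP.
Qed.

Lemma strong_connectivity_ge0 K e : 0 <= strong_connectivity K e.
Proof.
rewrite /strong_connectivity; set S := [set k | _]%classic.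
(* Without a supremum, [sup] takes the default value 0. *)
have [supS|/sup_out->//] := boolp.pselect (has_sup S).
have [[k Sk] _] := supS; have [k0 _] := Sk.
exact: le_trans k0 (ub_le_sup supS.2 Sk).
Qed.

(* [c <= rho * w] and [1 <= w] are all that is used of the sampling weight
   [w = max (c / rho) 1]. *)
Lemma sampling_weight (rho : R) K e : 0 < rho ->
  1 <= (sampling_prob rho K e)^-1 /\
  strong_connectivity K e <= rho * (sampling_prob rho K e)^-1.
Proof.
move=> rho0; rewrite /sampling_prob.
have := strong_connectivity_ge0 K e; set c := strong_connectivity K e.
have [->|cN0 c0] := eqVneq c 0; first by rewrite invr1; split=> //; lra.
have {cN0 c0} c0 : 0 < c by rewrite lt_def cN0.
rewrite /Num.min; case: ifP => [h|/negbT].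
  rewrite invf_div [rho * _]mulrC divfK ?gt_eqF //; split=> //.
  by move: h; rewrite ltr_pdivrMr // mul1r ler_pdivlMr // mul1r => /ltW.
by rewrite -leNgt ler_pdivlMr // mul1r invr1 mulr1.
Qed.

(** The invariant that replaces the coins. Edges are only appended, so the prefix [H1] is exactly
    the graph in which the strong connectivity of [f] was measured. *)
Definition sampled (rho : R) H : Prop :=
  forall H1 f H2, H = H1 ++ f :: H2 ->
    [/\ is_edge f.1, 1 <= f.2 & strong_connectivity H1 f.1 <= rho * f.2].

Lemma sampled_mem (rho : R) H f : sampled rho H -> f \in H ->
  is_edge f.1 /\ 1 <= f.2.
Proof. by move=> sH fH; case/splitPr: fH sH => H1 H2 /(_ H1 f H2 erefl)[]. Qed.

Lemma sampled_run (rho : R) K (es : seq {set V}) (bs : seq bool) :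
  0 < rho -> all (@is_edge V) es -> sampled rho K ->
  sampled rho (run rho K es bs).
Proof.
move=> rho0; elim: es bs K => [|e es IH] [|b bs] K //= /andP[e2 es2] sK.
apply: IH => //; rewrite /step; case: b => // H1 f H2.
have [w1 wc] := @sampling_weight rho K e rho0.
case/lastP: H2 => [|H2 g].
  by rewrite cats1 => /rcons_inj[<- <-].
by rewrite -rcons_cons -rcons_cat => /rcons_inj[/sK].
Qed.

Lemma count_weight_level (rho b w : R) (t : nat) H :
    0 < rho -> 0 <= w -> rho * b <= t%:R -> sampled rho H ->
  (count (fun f => (w <= f.2 < w * b)%R) H <= #|V|.-1 * t)%N.
Proof.
move=> rho0 w0 tb sH; pose p (f : {set V} * R) := w <= f.2 < w * b.
pose S := [seq f.1 | f <- H & p f].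
have -> : count p H = count (fun e => e \subset [set: V]) S.
  rewrite count_map count_filter; apply: eq_count => f /=.
  by rewrite subsetT.
rewrite -cardsT; apply: count_le_of_small_cuts.
  apply/allP=> e /mapP[f]; rewrite mem_filter => /andP[_ fH] ->.
  by case: (sampled_mem sH fH).
move=> U U1.
case: (boolP [exists C : {set {set V}}, cut U C &&
   (count (fun e => (e \subset U) && crosses C e) S <= t)%N]).
  by case/existsP=> C /andP[]; exists C.
move=> noC; pose q C (f : {set V} * R) := [&& f.1 \subset U, crosses C f.1 & p f].
have bigC C : cut U C ->
   (t < count (q C) H)%N.
  move=> cutC; move/existsPn/(_ C): noC; rewrite cutC -ltnNge /S count_map count_filter.
  congr (_ < _)%N; apply: eq_count => f /=.
  by rewrite /q /= andbA.
(* The last edge of this level inside [U] was sampled when [U] was already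
   [t * w]-strongly connected. *)
have /last_occurrence[H1 [f [H2 [defH /andP[fU pf] NH2]]]] :
    has (fun f : {set V} * R => (f.1 \subset U) && p f) H.
  have [C /bigC] := exists_cut U1; rewrite has_count => /(leq_ltn_trans (leq0n t)).
  move/leq_trans; apply; apply: sub_count => f /and3P[-> _ ->] //.
have [f2 _ fc] := sH _ _ _ defH.
(* This contradicts the level of [f]: [t * w <= rho * f.2 < rho * b * w <= t * w]. *)
suff : t%:R * w <= strong_connectivity H1 f.1.
  have /andP[wf fwb] := pf.
  move=> h; have : rho * f.2 < rho * (w * b) by rewrite ltr_pM2l.
  by have : rho * b * w <= t%:R * w by [apply: ler_wpM2r]; lra.
apply: (@le_strong_connectivity _ _ U) => //.
- move=> g gH1; have [] := @sampled_mem rho H g sH; last by lra.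
  by rewrite defH mem_cat gH1.
- by rewrite mulr_ge0 // ler0n.
apply/forall_inP => C cutC.
have := bigC C cutC; rewrite defH count_cat /=.
have -> : count (q C) H2 = 0%N.
  apply/eqP; rewrite eqn0Ngt -has_count; apply: contra NH2.
  by apply: sub_has => g /and3P[-> _ ->].
(* More than [t] edges of the level cross [C] in [H], none of them after [f]; discarding [f] itself
   still leaves [t] in [H1], each of weight at least [w]. *)
rewrite addn0 => tC.
have {}tC : (t <= count (q C) H1)%N.
  by move: tC; case: (X in nat_of_bool X); lia.
apply: le_trans (_ : (count (q C) H1)%:R * w <= _).
  by rewrite ler_wpM2r // ler_nat.
have pos g : g \in H1 -> 0 <= g.2.
  move=> gH1; have [] := @sampled_mem rho H g sH; last by lra.
  by rewrite defH mem_cat gH1.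
rewrite /cut_value big_filter_cond /=.
elim: H1 pos {defH fc tC} => [|g H1 IH] pos; first by rewrite big_nil mul0r.
have {}IH : (count (q C) H1)%:R * w <=
    \sum_(i <- H1 | (i.1 \subset U) && crosses C i.1) i.2.
  by apply: IH => h hH; apply: pos; rewrite inE hH orbT.
have g0 := pos g (mem_head _ _).
rewrite big_cons /= natrD mulrDl {1}/q.
case: (g.1 \subset U) => /=; last by rewrite mul0r add0r.
case: (crosses C g.1) => /=; last by rewrite mul0r add0r.
apply: lerD => //; rewrite /p.
case: (boolP (w <= g.2)) => /= [wg|_]; last by rewrite mul0r.
by case: (g.2 < _); rewrite ?mul1r ?mul0r.
Qed.

(** * Total weight from singleton cuts *)

Lemma singleton_cut_crosses (v : V) e : is_edge e ->
  crosses [set [set v]; ~: [set v]]%SET e = (v \in e).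
Proof.
move=> /eqP e2; rewrite crosses_set2.
have -> : (e :&: [set v] != set0) = (v \in e).
  by rewrite setI_eq0 disjoint_sym disjoints1 negbK.
case: (boolP (v \in e)) => //= ve.
rewrite -setDE -card_gt0; move: e2; rewrite (cardsD1 v) ve.
by case: #|_|.
Qed.

(** Handshake count: an edge crosses exactly the singleton cuts of its two ends. *)
Lemma sum_singleton_cuts K : (forall f, f \in K -> is_edge f.1) ->
  \sum_(v : V) cut_value [set [set v]; ~: [set v]]%SET K = 2 * \sum_(f <- K) f.2.
Proof.
move=> Kedge; rewrite /cut_value.
rewrite (exchange_big_dep predT) //= mulr_sumr big_seq [RHS]big_seq.
apply: eq_bigr => f fK; have f2 := Kedge f fK.
rewrite (eq_bigl (fun v => v \in f.1)); last first.
  by move=> v; rewrite singleton_cut_crosses.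
by rewrite sumr_const (eqP f2) mulr_natl.
Qed.

Lemma total_weight_le (eps : R) (G : seq {set V}) H :
    (1 < #|V|)%N -> all (@is_edge V) G -> (forall f, f \in H -> is_edge f.1) ->
    cut_approx eps (unit_wgraph R G) H ->
  \sum_(f <- H) f.2 <= (1 + eps) * (size G)%:R.
Proof.
move=> V1 Gedge Hedge approx.
have -> : (size G)%:R = \sum_(f <- unit_wgraph R G) f.2 :> R.
  by rewrite big_map /= big_const_seq count_predT iter_addr_0.
rewrite -(@ler_pM2l _ 2) // mulrCA -!sum_singleton_cuts //; last first.
  by move=> f /mapP[e eG ->]; apply: (allP Gedge).
rewrite mulr_sumr; apply: ler_sum => v _.
have cutv : cut [set: V] [set [set v]; ~: [set v]]%SET.
  rewrite -(setUCr [set v]%SET); apply: cut_set2.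
  - by rewrite -setI_eq0 setICr.
  - by rewrite cards1.
  - by move: (cardsC [set v]%SET); rewrite cards1; lia.
by have /andP[] := approx _ cutv.
Qed.

(** All weights are at least [1 = b^0], so the first [L] levels hold all edges lighter than [b^L].
    The heavier ones number at most [W / b^L], by Markov's inequality. *)
Lemma size_sampled_le (rho b W : R) (t L : nat) H :
    0 < rho -> 1 < b -> rho * b <= t%:R -> sampled rho H -> \sum_(f <- H) f.2 <= W ->
  (size H)%:R <= #|V|%:R * t%:R * L%:R + W / b ^+ L.
Proof.
move=> rho0 b1 tb sH HW.
have b0 i : 0 < b ^+ i by rewrite exprn_gt0 //; lra.
have levels : (size H <= #|V| * t * L + count (fun f => (b ^+ L <= f.2)%R) H)%N.
  elim: L => [|L IH].
    rewrite muln0 add0n -count_predT; apply: eq_leq; apply: eq_in_count => f fH.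
    by rewrite expr0; have [_ ->] := sampled_mem sH fH.
  apply: leq_trans IH _; rewrite mulnS.
  have := @count_weight_level rho b (b ^+ L) t H rho0 (ltW (b0 L)) tb sH.
  have : (#|V|.-1 * t <= #|V| * t)%N by rewrite leq_mul2r leq_pred orbT.
  suff : (count (fun f => (b ^+ L <= f.2)%R) H <=
     count (fun f => (b ^+ L <= f.2 < b ^+ L * b)%R) H +
     count (fun f => (b ^+ L.+1 <= f.2)%R) H)%N by lia.
  elim: (H) => //= f H' IH.
  suff : ((b ^+ L <= f.2)%R <= (b ^+ L <= f.2 < b ^+ L * b)%R + (b ^+ L.+1 <= f.2)%R)%N.
    by move: IH; lia.
  by rewrite exprSr; case: (ltrP f.2 (b ^+ L * b)) => _; case: (b ^+ L <= f.2).
apply: le_trans (_ : (#|V| * t * L + count (fun f => (b ^+ L <= f.2)%R) H)%:R <= _).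
  by rewrite ler_nat.
rewrite natrD !natrM lerD2l ler_pdivlMr //; apply: le_trans HW.
have pos f : f \in H -> 0 <= f.2 by move=> /(sampled_mem sH)[_]; lra.
elim: (H) pos => [|f H' IH] pos; first by rewrite big_nil mul0r.
rewrite big_cons /= natrD mulrDl; apply: lerD.
  have := pos f (mem_head _ _).
  by case: (boolP (b ^+ L <= f.2)); rewrite ?mul1r ?mul0r.
by apply: IH => g gH; apply: pos; rewrite inE gH orbT.
Qed.

End Weighted.

(** * Rounding the number of levels, and the numerical estimate *)

Section Analysis.
Variable R : realType.
Implicit Types (b x y : R).

Lemma nat_between x : 0 <= x -> exists t : nat, x <= t%:R <= x + 1.
Proof.
move=> x0; exists (Num.truncn x).+1.
have /andP[tx xt] := truncn_itv x0.
by rewrite (ltW xt) /= -natr1 lerD2r.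
Qed.

Lemma exists_levels b y : 1 < b -> 1 <= y ->
  exists2 L : nat, y <= b ^+ L & L%:R <= ln y / ln b + 1.
Proof.
move=> b1 y1; have lnb : 0 < ln b by apply: ln_gt0.
have [L /andP[xL Lx]] : exists L : nat, ln y / ln b <= L%:R <= ln y / ln b + 1.
  by apply: nat_between; rewrite divr_ge0 ?ln_ge0 // ltW.
exists L => //.
have y0 : 0 < y by lra.
have b0 : 0 < b by lra.
rewrite -ler_ln ?posrE ?exprn_gt0 // lnXn // -mulr_natl.
by rewrite -ler_pdivrMr.
Qed.

(** The coefficients collected at the end of [level_bound]. *)
Definition size_constant (delta : R) : R :=
  320 * (1 / delta + 1) / ln 2 + 325 / (ln 2 * delta) + 2 / ln 2 ^+ 2
  + 320 / delta.

(** Here [l] stands for [ln m - ln n], [beta] for [ln b] and [x] for the logarithm of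
    [(1 + eps) * m / n] to base [b]. The danger is [ln (1 + eps)] for large [eps]: in [rho * x] it
    is absorbed by [rho * eps <= 160 * X], and in [x] alone by the bound through [beta]. *)
Lemma level_bound (delta eps A l rho beta x t L : R) :
    let c := ln 2 in
    let X := A * ((1 + eps) ^+ 2 / eps ^+ 2) in
    0 < delta -> delta <= l -> 0 < eps -> c <= A -> 0 < rho ->
    rho <= 160 * A * (1 + eps) / eps ^+ 2 ->
    c <= beta -> ln (1 + eps) <= beta + 160 * X ->
    x = (ln (1 + eps) + l) / beta -> 0 <= L ->
    t <= 2 * rho + 2 -> L <= x + 1 ->
  t * L + 1 <= size_constant delta * (X * l).
Proof.
move=> c X delta0 deltal eps0 cA rho0 rhoA cbeta lneps xE L0 tle Lle.
have c0 : 0 < c by apply: ln_gt0; lra.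
have l0 : 0 < l by lra.
have beta0 : 0 < beta by lra.
have lneps0 : 0 <= ln (1 + eps) by apply: ln_ge0; lra.
have lneps1 : ln (1 + eps) <= eps by apply: le_ln1Dx; lra.
pose s := eps^-1.
have s0 : 0 < s by rewrite invr_gt0.
have es : eps * s = 1 by rewrite divff ?gt_eqF.
have rE : (1 + eps) ^+ 2 / eps ^+ 2 = (1 + s) ^+ 2.
  rewrite -exprVn -exprMn mulrDl mul1r es addrC //.
have AX : A <= X by rewrite /X rE ler_peMr //; [lra | nra].
have A0 : 0 < 160 * A by lra.
have {}rhoA : rho <= 160 * A * (s * (1 + s)).
  suff <- : 160 * A * (1 + eps) / eps ^+ 2 = 160 * A * (s * (1 + s)) by [].
  by rewrite /s; field; rewrite gt_eqF.
have rhoX : rho <= 160 * X.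
  by apply: le_trans rhoA _; rewrite /X rE mulrA ler_pM2l //; nra.
have rhoepsX : rho * eps <= 160 * X.
  apply: le_trans (_ : 160 * A * (s * (1 + s)) * eps <= _).
    by rewrite ler_pM2r.
  rewrite -[leLHS]mulrA /X rE [leRHS]mulrA ler_pM2l //.
  by rewrite mulrAC [s * eps]mulrC es; nra.
have cX : c <= X by lra.
have X0 : 0 < X by lra.
have rhox : rho * x <= 160 * X * (1 + l) / c.
  rewrite xE mulrA; apply: ler_pM => //.
  - by rewrite mulr_ge0 //; lra.
  - by rewrite invr_ge0 ltW.
  - by nra.
  - by rewrite lef_pV2.
have xle : x <= 1 + 160 * X / c + l / c.
  apply: le_trans (_ : 1 + 160 * X / beta + l / beta <= _).
    have -> : 1 + 160 * X / beta + l / beta = (beta + 160 * X + l) / beta.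
      by field; rewrite gt_eqF.
    by rewrite xE ler_pM2r ?invr_gt0 //; lra.
  by apply: lerD; [rewrite lerD2l|]; rewrite ler_pM2l ?lef_pV2 //; lra.
(* This is [(2 * rho + 2) * (x + 1) + 1] expanded. *)
apply: le_trans (_ : 2 * (rho * x) + 2 * x + 2 * rho + 3 <= _).
  by nra.
apply: le_trans (_ : 320 * (X * (1 + l) / c) + 2 * (1 + 160 * X / c + l / c)
   + 320 * X + 3 <= _).
  by lra.
have h1 : 1 <= X / c by rewrite ler_pdivlMr // mul1r.
have h2 : 1 <= l / delta by rewrite ler_pdivlMr // mul1r.
have ic0 : 0 < c^-1 by rewrite invr_gt0.
have id0 : 0 < delta^-1 by rewrite invr_gt0.
have h3 : 1 <= X / c * (l / delta) by nra.
have h4 : X / c <= X / c * (l / delta) by nra.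
have h5 : l / c <= X / c * (l / c) by rewrite ler_peMl // divr_ge0 // ltW.
have h6 : X <= X * (l / delta) by rewrite ler_peMr // ltW.
have -> : size_constant delta * (X * l) =
   320 * (X / c * (l / delta) + X * l / c) + 325 * (X / c * (l / delta)) +
   2 * (X / c * (l / c)) + 320 * (X * (l / delta)).
  by rewrite /size_constant -/c; field; rewrite !gt_eqF.
lra.
Qed.

End Analysis.

(** * Choice of base, level size and number of levels *)

Theorem theorem4 (R : realType) (delta : R) (hdelta : 0 < delta) :
  exists K : R,
  forall (d eps : R) (V : finType) (G : seq {set V}) (H : wgraph R V),
    let n := #|V| in
    let m := size G in
    0 < d -> 0 < eps ->
    all (@is_edge V) G ->
    delta <= ln m%:R - ln n%:R ->
    stream_sparsification_output (sparsification_rho d eps n m) G H ->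
    cut_approx eps (unit_wgraph R G) H ->
    (size H)%:R <=
      K * (n%:R * (d * ln n%:R + ln m%:R) * (ln m%:R - ln n%:R)
           * ((1 + eps) ^+ 2 / eps ^+ 2)).
Proof.
exists (size_constant delta) => d eps V G H n m d0 eps0 Gedge.
set l := ln m%:R - ln n%:R => deltal.
set rho := sparsification_rho d eps n m => -[bs _ HE] approx.
have lnn0 : 0 <= ln n%:R :> R.
  by case: (n) => [|k]; [rewrite ln0 | apply: ln_ge0; rewrite ler1n].
have m0 : (0 < m)%N.
  rewrite lt0n; apply: contraTneq deltal => m0.
  (* With the convention [ln 0 = 0], an empty stream would give [l <= 0]. *)
  by rewrite /l m0 ln0 // -ltNge; lra.
have n2 : (1 < n)%N.
  have [e eG] : exists e, e \in G.
    by move: m0; rewrite /m; case: (G) => // e G' _; exists e; rewrite mem_head.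
  by rewrite -(eqP (allP Gedge e eG)) max_card.
have nR : 2 <= n%:R :> R by rewrite ler_nat.
have mR : 1 <= m%:R :> R by rewrite ler1n.
have ln2n : ln 2 <= ln n%:R :> R by rewrite ler_ln ?posrE //; lra.
have c0 : 0 < ln 2 :> R by apply: ln_gt0; lra.
set A := d * ln n%:R + ln m%:R.
have dn0 : 0 <= d * ln n%:R by rewrite mulr_ge0 // ltW.
have lnmn : ln n%:R <= ln m%:R :> R by rewrite /l in deltal; lra.
have cA : ln 2 <= A by rewrite /A; lra.
have A'0 : 0 < (4 + d) * ln n%:R + ln m%:R by rewrite mulrDl; lra.
(* Since [ln n <= ln m]; the constant 160 below is [32 * 5]. *)
have A'A : (4 + d) * ln n%:R + ln m%:R <= 5 * A by rewrite /A mulrDl; lra.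
have eps20 : 0 < eps ^+ 2 by rewrite exprn_gt0.
have rho0 : 0 < rho.
  by rewrite /rho /sparsification_rho divr_gt0 // mulr_gt0 ?mulr_gt0 //; lra.
have rhoA : rho <= 160 * A * (1 + eps) / eps ^+ 2.
  rewrite /rho /sparsification_rho ler_pM2r ?invr_gt0 // ler_pM2r; lra.
(* The base [1 / rho] keeps the number of levels bounded when [eps] is so large
   that [rho] is tiny. *)
pose b := Num.max 2 rho^-1.
have b2 : 2 <= b by rewrite le_max lexx.
have rb : 1 <= rho * b.
  by rewrite -ler_pdivrMl // mulr1 le_max lexx orbT.
have rb2 : rho * b <= 2 * rho + 1.
  rewrite /b; case: (leP 2 rho^-1) => _; last by lra.
  by rewrite mulfV ?gt_eqF //; lra.
have [t /andP[rbt trb]] : exists t : nat, rho * b <= t%:R <= rho * b + 1.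
  by apply: nat_between; lra.
pose X := A * ((1 + eps) ^+ 2 / eps ^+ 2).
have X0 : 0 < X by rewrite mulr_gt0 ?divr_gt0 ?exprn_gt0 //; lra.
(* From [1 <= rho * b] and the upper bound on [rho] comes [1 + eps <= b * (160 * X)]; then take
   logarithms. *)
have lneps : ln (1 + eps) <= ln b + 160 * X.
  have le1 : 1 + eps <= b * (160 * X).
    have -> : b * (160 * X) = (1 + eps) * (b * (160 * A * (1 + eps) / eps ^+ 2)).
      by rewrite /X; field; rewrite gt_eqF.
    rewrite ler_peMr; [by []|lra|].
    by apply: le_trans rb _; rewrite mulrC ler_pM2l //; lra.
  apply: le_trans (_ : ln (b * (160 * X)) <= _).
    by rewrite ler_ln ?posrE //; [lra | apply: lt_le_trans le1; lra].
  rewrite lnM ?posrE; [|lra|lra].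
  rewrite lerD2l; apply: le_trans (_ : ln (1 + 160 * X) <= _).
    by rewrite ler_ln ?posrE; lra.
  by apply: le_ln1Dx; lra.
have n0 : 0 < n%:R :> R by lra.
have yE : ln ((1 + eps) * m%:R / n%:R) = ln (1 + eps) + l.
  by rewrite ln_div ?lnM ?posrE ?addrA //; [lra|lra|rewrite mulr_gt0; lra].
have nm : n%:R <= m%:R :> R by rewrite -ler_ln ?posrE //; lra.
have [||L yL Lle] := @exists_levels R b ((1 + eps) * m%:R / n%:R).
- lra.
- by rewrite ler_pdivlMr // mul1r; nra.
have sH : sampled rho H.
  by rewrite HE; apply: sampled_run => // -[|? ?] ? ?.
have HW : \sum_(f <- H) f.2 <= (1 + eps) * m%:R.
  by apply: total_weight_le => // f /(sampled_mem sH)[].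
have b1 : 1 < b by lra.
have := size_sampled_le L rho0 b1 rbt sH HW.
move/le_trans; apply.
(* As [b^L >= (1 + eps) * m / n], at most [n] edges lie beyond the first [L] levels. *)
apply: le_trans (_ : n%:R * (t%:R * L%:R + 1) <= _).
  rewrite mulrDr mulr1 mulrA lerD2l ler_pdivrMr ?exprn_gt0 //; last lra.
  by rewrite [leRHS]mulrC -ler_pdivrMr.
have -> : forall k : R, k * (n%:R * A * l * ((1 + eps) ^+ 2 / eps ^+ 2)) =
   n%:R * (k * (X * l)) by move=> k; rewrite /X; ring.
rewrite ler_pM2l //.
apply: (level_bound (beta := ln b) hdelta deltal eps0 cA rho0 rhoA _ lneps erefl) => //.
- by rewrite ler_ln ?posrE //; lra.
- by lra.
- by rewrite -yE.
Qed.
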